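(* Let $\Sigma$ be a finite alphabet with at least two letters, let $n\ge 2$ and $1\le k\le n-1$ be integers with $k\ge n/2$. Then every maximal $(1,k)$-overlap-free code in $\Sigma^n$ is of the form $C\big((L_i,R_i)_{i\in\{1,\dots,k\}}\big)$ for some admissible family $(L_i,R_i)_{i\in\{1,\dots,k\}}$.
   Context: For sets of words $L,R$, $LR$ denotes the set of all concatenations $lr$ with $l\in L$, $r\in R$. A composition of a positive integer $m$ is a tuple $\alpha=(\alpha_1,\dots,\alpha_p)$ of positive integers with sum $m$; $\mathrm{par}(\alpha)=p$ is its number of parts; the only composition of $0$ is the empty one, with $\mathrm{par}=0$. Two (not necessarily distinct) words $u,v$ have a $t$-overlap if the prefix of $u$ of length $t$ equals the suffix of $v$ of length $t$, or vice versa. A code $C\subseteq\Sigma^n$ is $(1,k)$-overlap-free if for all $1\le t\le k$ no two (not necessarily distinct) codewords have a $t$-overlap. A $(1,k)$-overlap-free code $C\subseteq\Sigma^n$ is maximal if for every $w\in\Sigma^n\setminus C$ the code $C\cup\{w\}$ is not $(1,k)$-overlap-free. A family $(L_i,R_i)_{i\in\{1,\dots,k\}}$ is admissible if $(L_1,R_1)$ is a partition of $\Sigma$ into two non-empty parts and, for every $i\in\{2,\dots,k\}$, $(L_i,R_i)$ is a partition of $\bigcup_{j=1}^{i-1}L_jR_{i-j}$ into two disjoint, possibly empty, parts. The associated code is $$C\big((L_i,R_i)_i\big)=\bigcup_{s=k+1}^{n}\ \bigcup_{j=s-k}^{k}\ \bigcup_{\alpha}\ \bigcup_{i=0}^{\mathrm{par}(\alpha)}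 L_{\alpha_1}\cdots L_{\alpha_i}\,L_jR_{s-j}\,R_{\alpha_{i+1}}\cdots R_{\alpha_{\mathrm{par}(\alpha)}}\subseteq\Sigma^n,$$ where $\alpha$ ranges over all compositions of $n-s$. *)

(* Defs.v *)
From mathcomp Require Import all_boot.
From mathcomp Require Import boolp classical_sets.

Set Implicit Arguments.
Unset Strict Implicit.
Unset Printing Implicit Defensive.

Local Open Scope classical_set_scope.

Section Words.
Variable T : Type.
Implicit Types (u v w : seq T) (A B C : set (seq T)).

Definition words n : set (seq T) := [set w | size w = n].

Definition conc A B : set (seq T) := [set u ++ v | u in A & v in B].

(* Meaningful only for [t <= size u] and [t <= size v], since [take] and [drop]
   return the whole word when [t] is too large. *)
Definition overlap t u v : Prop :=
  take t u = drop (size v - t) v \/ take t v = drop (size u - t) u.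

Definition overlap_free k C : Prop :=
  forall t u v, 1 <= t <= k -> C u -> C v -> ~ overlap t u v.

Definition maximal_overlap_free n k C : Prop :=
  [/\ C `<=` words n,
      overlap_free k C
    & forall w, (words n `\` C) w -> ~ overlap_free k (C `|` [set w])].

Definition bipartition A L R : Prop := L `|` R = A /\ L `&` R = set0.

(* Letters are identified with words of length 1.  A family indexed by
   {1, ..., k} is given by functions on [nat]; the values outside {1, ..., k}
   are irrelevant. *)
Definition admissible k (L R : nat -> set (seq T)) : Prop :=
  [/\ bipartition (words 1) (L 1) (R 1),
      L 1 !=set0,
      R 1 !=set0
    & forall i, 2 <= i <= k ->
        bipartition (\bigcup_(j in [set j | 1 <= j < i]) conc (L j) (R (i - j)))
                    (L i) (R i)].

Definition composition m : set (seq nat) :=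
  [set a | all (fun p => 0 < p) a /\ sumn a = m].

Definition concs (F : nat -> set (seq T)) (a : seq nat) : set (seq T) :=
  \big[conc/[set [::]]]_(p <- a) F p.

(* The parts of the compositions involved are at most [n - k - 1], hence lie in
   {1, ..., k} whenever [n <= 2 * k]; all the subtractions below are exact. *)
Definition assoc_code n k (L R : nat -> set (seq T)) : set (seq T) :=
  \bigcup_(s in [set s | k.+1 <= s <= n])
  \bigcup_(j in [set j | s - k <= j <= k])
  \bigcup_(a in composition (n - s))
  \bigcup_(i in [set i | i <= size a])
    conc (concs L (take i a))
         (conc (conc (L j) (R (s - j))) (concs R (drop i a))).

End Words.

(* Main.v *)
(** Let [L] consist of the words built from the letters by the rule of an
    admissible family that are prefixes of codewords of [C], and [R] of those
    that are not.  Proper prefixes of words in [L] or [R] are products of words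
    in [L], proper suffixes are products of words in [R], and no nonempty word
    is both a product over [L] and a product over [R]; hence the associated code
    is overlap-free.  Conversely, split a codeword of [C] into letters and merge
    adjacent factors [L_j], [R_i] as long as [i + j <= k].  At the end the first
    factor is in [L], being a prefix, and the last one in [R], being a suffix;
    any two adjacent factors in [L], [R] have total length at least [k + 1], and
    as [n <= 2 k] there is only one such pair.  So [C] is contained in the
    associated code, and maximality gives equality. *)
Require Import Defs.
From mathcomp Require Import all_boot.
From mathcomp Require Import boolp classical_sets.
From mathcomp Require Import zify.

Set Implicit Arguments.
Unset Strict Implicit.
Unset Printing Implicit Defensive.

Local Open Scope classical_set_scope.

Lemma cat_eq_cat (T : Type) (u v x y : seq T) : u ++ v = x ++ y ->
  (exists2 z, x = u ++ z & v = z ++ y) \/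
  (exists2 z, u = x ++ z /\ z <> [::] & y = z ++ v).
Proof.
elim: u x => [|a u IH] [|b x] /=; first by move=> ->; left; exists [::].
- by move=> ->; left; exists (b :: x).
- by move=> <-; right; exists (a :: u).
case=> -> /IH [[z -> ->]|[z [-> z0] ->]]; first by left; exists z.
by right; exists z.
Qed.

(** Used on a factorization of a codeword, to locate the first place where a factor in [L] is
    followed by a factor in [R]. *)
Lemma first_change (T : Type) (P : pred T) (x : T) (s : seq T) :
  P x -> ~~ P (last x s) -> exists s1 u v s2,
  [/\ x :: s = s1 ++ [:: u, v & s2], all P s1, P u & ~~ P v].
Proof.
elim: s x => [|y s IH] x Px /=; first by rewrite Px.
case: (boolP (P y)) => Py Pl; last by exists [::], x, y, s.
have [s1 [u [v [s2 [-> Ps1 Pu Pv]]]]] := IH y Py Pl.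
by exists (x :: s1), u, v, s2; rewrite /= Px.
Qed.

(** * Products of words and their prefixes and suffixes *)

Section Star.
Variable T : Type.
Implicit Types (A : set (seq T)) (u v w : seq T) (F : nat -> set (seq T)).

Inductive star A : set (seq T) :=
| star_nil : star A [::]
| star_cons u v : A u -> star A v -> star A (u ++ v).

Lemma star1 A u : A u -> star A u.
Proof. by move=> Au; rewrite -[u]cats0; apply: star_cons => //; apply: star_nil. Qed.

Lemma star_cat A u v : star A u -> star A v -> star A (u ++ v).
Proof. by elim=> // {}u w Au _ IH /IH ?; rewrite -catA; apply: star_cons. Qed.

(** The cut falls inside one factor; the factors before it are kept whole. *)
Lemma star_prefix A : (forall p q, A (p ++ q) -> star A p) ->
  forall p q, star A (p ++ q) -> star A p.
Proof.
move=> HA p q; move E: (p ++ q) => w Hw.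
elim: Hw p q E => [|u v Au Av IH] p q.
  by case: p => // _; apply: star_nil.
case/cat_eq_cat => [[z Eu _]|[z [-> _] /esym/IH Hz]].
  by apply: (HA p z); rewrite -Eu.
exact: star_cons.
Qed.

Lemma star_suffix A : (forall p q, A (p ++ q) -> star A q) ->
  forall p q, star A (p ++ q) -> star A q.
Proof.
move=> HA p q; move E: (p ++ q) => w Hw.
elim: Hw p q E => [|u v Au Av IH] p q.
  by case: p => //= ->; apply: star_nil.
case/cat_eq_cat => [[z Eu ->]|[z [_ _] /esym/IH //]].
by apply: star_cat => //; apply: (HA p z); rewrite -Eu.
Qed.

Lemma concs_star A F a : (forall p, F p `<=` A) -> concs F a `<=` star A.
Proof.
move=> FA; elim: a => [|p a IH] w; rewrite /concs ?big_nil ?big_cons.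
  by move=> ->; apply: star_nil.
by case=> u /FA Au [v /IH Hv <-]; apply: star_cons.
Qed.

Lemma concs_size F a w :
  (forall p, F p `<=` words p) -> concs F a w -> size w = sumn a.
Proof.
move=> FA; elim: a w => [|p a IH] w; rewrite /concs ?big_nil ?big_cons.
  by move=> ->.
by case=> u /FA /= <- [v /IH Hv <-]; rewrite size_cat Hv.
Qed.

Lemma concs_flatten F ss :
  all (fun s => `[< F (size s) s >]) ss -> concs F (map size ss) (flatten ss).
Proof.
rewrite /concs; elim: ss => [|s ss IH] /=; first by rewrite big_nil.
case/andP=> /asboolP Fs /IH Hss; rewrite big_cons.
by exists s => //; exists (flatten ss).
Qed.

End Star.

(** * The family cut out by a predicate *)

Section SplitFamily.
Variables (T : Type) (pre : set (seq T)).
Implicit Types (u v w p q : seq T).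

(* An admissible family whose members [L_i] are cut out of the unions by a fixed
   predicate needs no recursion on [i]: the index is the length of the word. *)
Inductive node : set (seq T) :=
| node_letter x : node [:: x]
| node_cat u v : node u -> pre u -> node v -> ~ pre v -> node (u ++ v).

Definition lnode := node `&` pre.
Definition rnode := node `\` pre.
Definition lpart i := lnode `&` words i.
Definition rpart i := rnode `&` words i.

Lemma node_neq0 w : node w -> 0 < size w.
Proof. by elim=> // u v _ ? _ _ _ _; rewrite size_cat; lia. Qed.

(** Induction on the way the node is built. The cut falls inside [u], or at its end, where [u]
    itself is in [lnode], or inside [v], and then [u] is the first factor. *)
Lemma node_prefix p q : node (p ++ q) -> q <> [::] -> star lnode p.
Proof.
move E: (p ++ q) => w Hw.
elim: Hw p q E => [x|u v nu IHu pu nv IHv pv] p q.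
  case: p => [|y p] //=; first by move=> _ _; apply: star_nil.
  by case=> _; case: p => // ->.
case/cat_eq_cat => [[z Eu Eq] q0|[z [-> z0] Ez] q0].
  case: z => [|a z] in Eu Eq.
    by rewrite cats0 in Eu; rewrite -Eu; apply: star1.
  by apply: (IHu p (a :: z)).
by apply: star_cons => //; apply: (IHv z q).
Qed.

Lemma node_suffix p q : node (p ++ q) -> p <> [::] -> star rnode q.
Proof.
move E: (p ++ q) => w Hw.
elim: Hw p q E => [x|u v nu IHu pu nv IHv pv] p q.
  by case: p => [|y [|? ?]] //= [_ ->] _; apply: star_nil.
case/cat_eq_cat => [[z Eu ->] p0|[z [_ z0] Ez] _].
  by apply: star_cat; [apply: (IHu p) | apply: star1].
by apply: (IHv z).
Qed.

Lemma star_lnode_prefix p q : star lnode (p ++ q) -> star lnode p.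
Proof.
apply: star_prefix => {}p {}q [npq ppq].
case: q => [|a q] in npq ppq *; last by apply: node_prefix npq _.
by rewrite cats0 in npq ppq; apply: star1.
Qed.

Lemma star_rnode_suffix p q : star rnode (p ++ q) -> star rnode q.
Proof.
apply: star_suffix => {}p {}q [npq ppq].
by case: p => [|a p] in npq ppq *; [apply: star1 | apply: node_suffix npq _].
Qed.

Lemma star_lnode_rnode w : star lnode w -> star rnode w -> w = [::].
Proof.
have [m] := ubnP (size w); elim: m w => // m IH w szw Lw.
case: Lw szw => // l w1 [nl pl] Lw1; move E: (l ++ w1) => w' szw Rw.
case: Rw E szw => // r w2 [nr pr] Rw2 E szw.
have l0 := node_neq0 nl; have r0 := node_neq0 nr.
case/cat_eq_cat: E => [[z Er E1]|[z [El z0] E2]].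
(* [z] ends the node [r] and begins [w1], so it is a product of both kinds, hence empty by
   induction; then [r = l] would be both in and outside [pre]. *)
- rewrite E1 in Lw1; move: szw; rewrite Er !size_cat => szw.
  have Rz : star rnode z.
    by apply: (@node_suffix l); [rewrite -Er | move=> l_nil; rewrite l_nil in l0].
  have z0 : z = [::] by apply: IH (star_lnode_prefix Lw1) Rz; lia.
  by move: pr; rewrite Er z0 cats0.
(* Here [r] is a proper prefix of [l], hence a product over [lnode]; it is also in [rnode] and
   shorter than [w], so induction applies. *)
- have Lr : star lnode r by apply: (@node_prefix r z); rewrite -?El //.
  have r_nil : r = [::].
    apply: IH Lr (star1 _) => //; move: szw; rewrite E2 !size_cat.
    by case: (z) z0 => //= a z1 _; lia.
  by rewrite r_nil in r0.
Qed.

(** A node of length at least 2 is not a letter, so it comes from [node_cat]; the length of its left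
    factor supplies the index. *)
Lemma node_bigcup i : 2 <= i ->
  \bigcup_(j in [set j | 1 <= j < i]) conc (lpart j) (rpart (i - j)) =
  node `&` words i.
Proof.
move=> i2; apply/seteqP; split=> w.
  case=> j /= /andP[j1 ji] [u [[nu pu] /= su] [v [[nv pv] /= sv] <-]].
  by split; [apply: node_cat | rewrite /words /= size_cat su sv; lia].
case=> nw; rewrite {1}/words /= => sw.
case: nw sw => [x /= i1|u v nu pu nv pv]; first by lia.
rewrite size_cat => suv; have u0 := node_neq0 nu; have v0 := node_neq0 nv.
exists (size u) => /=; first by lia.
exists u; first by split.
by exists v => //; split => //; rewrite /words /=; lia.
Qed.

Lemma node_words1 : node `&` words 1 = words 1.
Proof.
apply/seteqP; split=> [w []//|[|x [|//]] //= _].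
by split => //; apply: node_letter.
Qed.

Lemma parts_bipartition i :
  bipartition (node `&` words i) (lpart i) (rpart i).
Proof.
split; apply/seteqP; split=> w //.
- by case=> [] [[]].
- by case=> nw sw; case: (EM (pre w)) => pw; [left|right].
- by case=> [[[_ pw] _] [[_ npw] _]].
Qed.

Lemma parts_admissible k :
  lpart 1 !=set0 -> rpart 1 !=set0 -> admissible k lpart rpart.
Proof.
move=> L0 R0; split=> //; first by rewrite -node_words1; apply: parts_bipartition.
by move=> i /andP[i2 _]; rewrite node_bigcup //; apply: parts_bipartition.
Qed.

(** * Overlap-freeness of the associated code *)

Variant assoc_word k w : Prop :=
  AssocWord a l r b of w = (a ++ l) ++ (r ++ b) & star lnode a & lnode l &
    rnode r & star rnode b & k < size l + size r.

Lemma assoc_codeP n k w :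
  assoc_code n k lpart rpart w -> size w = n /\ assoc_word k w.
Proof.
case=> s /= /andP[ks sn] [j /= /andP[sj jk]] [al /= [_ sum_al]] [i /= isz].
case=> a La [_ [_ [l [Ll szl] [r [Rr szr] <-]] [b Rb <-]] <-].
rewrite /words /= in szl szr.
have sza := concs_size (fun=> @subIsetr _ _ _ : lpart _ `<=` words _) La.
have szb := concs_size (fun=> @subIsetr _ _ _ : rpart _ `<=` words _) Rb.
split.
  move: sum_al; rewrite -[al in sumn al](cat_take_drop i) sumn_cat.
  by rewrite !size_cat; lia.
apply: (@AssocWord _ _ a l r b) => //; first by rewrite !catA.
- by apply: concs_star La => p; apply: subIsetl.
- by apply: concs_star Rb => p; apply: subIsetl.
- lia.
Qed.

(** As [l ++ r] is longer than [k], [p] stops before the end of [r]: inside [a ++ l], or after it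
    within a proper prefix of [r]. *)
Lemma assoc_word_prefix k p q :
  assoc_word k (p ++ q) -> size p <= k -> star lnode p.
Proof.
case=> a l r b E La Ll [nr _] _ klr pk.
have Lal : star lnode (a ++ l) by apply: star_cat => //; apply: star1.
case/cat_eq_cat: E => [[z E _]|[z [Ep _] /esym E]].
  by apply: (@star_lnode_prefix p z); rewrite -E.
rewrite Ep !size_cat in pk *; apply: star_cat => //.
case/cat_eq_cat: E => [[x Er _]|[x [Ez _] _]]; last first.
  by rewrite Ez size_cat in pk; lia.
rewrite Er in nr klr; apply: node_prefix nr _ => x0.
by rewrite x0 cats0 in klr; lia.
Qed.

Lemma assoc_word_suffix k p q :
  assoc_word k (p ++ q) -> size q <= k -> star rnode q.
Proof.
case=> a l r b E _ [nl _] Rr Rb klr qk.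
have Rrb : star rnode (r ++ b) by apply: star_cat => //; apply: star1.
case/esym/cat_eq_cat: E => [[z _ E]|[z [/esym E _] Eq]].
  by apply: (@star_rnode_suffix z q); rewrite -E.
rewrite Eq !size_cat in qk *; apply: star_cat => //.
case/cat_eq_cat: E => [[x _ Ez]|[x [_ _] El]].
  by rewrite Ez size_cat in qk; lia.
rewrite El in nl klr; apply: node_suffix nl _ => x0.
by rewrite x0 in klr; simpl in klr; lia.
Qed.

Lemma assoc_code_overlap_free n k :
  overlap_free k (assoc_code n k lpart rpart).
Proof.
move=> t u v t1k /assoc_codeP[szu au] /assoc_codeP[szv av].
(* The factors [l] and [r] together are longer than [k], so [t < n] and [take t u] has length
   exactly [t]. *)
have tn x : size x = n -> assoc_word k x -> t < n.
  by move=> <- [a l r b -> _ _ _ _]; rewrite !size_cat; lia.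
have {}tn := tn _ szu au.
wlog E : u v szu szv au av / take t u = drop (size v - t) v.
  by move=> W [] E; [apply: (W u v) | apply: (W v u)] => //; left.
move=> _; have st : size (take t u) = t by rewrite size_takel //; lia.
suff t0 : take t u = [::] by rewrite t0 /= in st; lia.
apply: star_lnode_rnode.
  by apply: (@assoc_word_prefix k _ (drop t u)); rewrite ?cat_take_drop //; lia.
apply: (@assoc_word_suffix k (take (size v - t) v)); last by lia.
by rewrite E cat_take_drop.
Qed.

(** * Factorization of a codeword into nodes *)

Definition factor k u := `[< node u >] && (size u <= k).

(** Start from letters and merge any pair violating the last condition: the result is again a node
    of length at most [k], and the number of factors drops. *)
Lemma reduced_factorization k w : 0 < k -> exists ss,
  [/\ flatten ss = w, all (factor k) ss
    & forall s1 u v s2, ss = s1 ++ [:: u, v & s2] -> pre u -> ~ pre v ->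
        k < size u + size v].
Proof.
move=> k0; pose letters := map (fun x : T => [:: x]) w.
have : flatten letters = w by rewrite flatten_map1 map_id.
have : all (factor k) letters.
  rewrite all_map; apply: sub_all (all_predT w) => x _ /=.
  by rewrite /factor k0 andbT; apply/asboolP; apply: node_letter.
have [m] := ubnP (size letters).
elim: m letters => // m IH ss ssm fss ssw.
have [red|] := EM (forall s1 u v s2, ss = s1 ++ [:: u, v & s2] -> pre u ->
  ~ pre v -> k < size u + size v); first by exists ss.
move=> /existsNP[s1] /existsNP[u] /existsNP[v] /existsNP[s2].
move=> /not_implyP[Ess] /not_implyP[pu] /not_implyP[pv] /negP; rewrite -leqNgt.
move=> uvk; apply: (IH (s1 ++ (u ++ v) :: s2)).
- by move: ssm; rewrite Ess !size_cat /=; lia.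
- move: fss; rewrite Ess !all_cat /= => /andP[-> /and3P[/andP[/asboolP nu _]]].
  move=> /andP[/asboolP nv _] ->; rewrite /factor size_cat uvk !andbT /=.
  by apply/asboolP; apply: node_cat.
- by rewrite -ssw Ess !flatten_cat /= -!catA.
Qed.

Lemma factorization_assoc_code n k w : 0 < k -> 0 < n <= 2 * k -> size w = n ->
  (forall p q, w = p ++ q -> 0 < size p <= k -> pre p) ->
  (forall p q, w = p ++ q -> 0 < size q <= k -> ~ pre q) ->
  assoc_code n k lpart rpart w.
Proof.
move=> k0 n2k szw prew nprew.
have [ss [ssw fss red]] := reduced_factorization w k0.
have factorP u : factor k u -> node u /\ 0 < size u <= k.
  by case/andP=> /asboolP nu ->; rewrite node_neq0.
case: ss => [|x ss] in ssw fss red *; first by rewrite -szw -ssw in n2k.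
pose P u := `[< pre u >].
have Px : P x.
  apply/asboolP/(prew _ (flatten ss)) => //.
  by case/andP: fss => /factorP[].
have nPl : ~~ P (last x ss).
  apply/asboolPn/(nprew (flatten (belast x ss))).
    by rewrite -ssw lastI -cats1 flatten_cat /= cats0.
  move: fss; rewrite lastI -cats1 all_cat => /andP[_] /=.
  by rewrite andbT => /factorP[].
have [s1 [u [v [s2 [E Ps1 Pu nPv]]]]] := first_change Px nPl.
have uv : k < size u + size v.
  by apply: (red _ _ _ _ E); [apply/asboolP | apply/asboolPn].
(* A factor of [s2] satisfying [P] would lead to a second change from [P] to its complement,
   disjoint from [u], [v]; the two pairs would have total length at least [2 * k + 2], more than
   [n]. *)
have nPs2 : all (predC P) s2.
  rewrite all_predC; apply/negP => /split_find; move: (take _ _) (drop _ _).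
  move=> t1 t2 s2P; case: s2 t1 t2 / s2P E => y s3 s4 Py _ E.
  have : ~~ P (last y s4).
    move: nPl; rewrite -[last x ss]/(last x (x :: ss)) E last_cat /=.
    by rewrite cat_rcons last_cat.
  case/(first_change Py) => [s5 [u' [v' [s6 [E' _ Pu' nPv']]]]].
  have E2 : x :: ss = (s1 ++ [:: u, v & s3] ++ s5) ++ [:: u', v' & s6].
    by rewrite E cat_rcons E' -!catA.
  have : k < size u' + size v'.
    by apply: (red _ _ _ _ E2); [apply/asboolP | apply/asboolPn].
  move: szw; rewrite -ssw E2 !flatten_cat /= !size_cat; lia.
have partsP t : all (factor k) t ->
    (all P t -> all (fun y => `[< lpart (size y) y >]) t) /\
    (all (predC P) t -> all (fun y => `[< rpart (size y) y >]) t).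
  elim: t => //= y t IH /andP[/factorP[ny _] /IH[IHl IHr]].
  split=> /andP[/asboolP py Pt].
    by rewrite IHl // andbT; apply/asboolP.
  by rewrite IHr // andbT; apply/asboolP; split => //; split => // /asboolP.
move: fss; rewrite E all_cat /= => /and4P[fs1 fu fv fs2].
have [nu uk] := factorP _ fu; have [nv vk] := factorP _ fv.
have [/(_ Ps1) Ls1 _] := partsP _ fs1; have [_ /(_ nPs2) Rs2] := partsP _ fs2.
have n_sum : n = sumn (map size s1) + (size u + size v) + sumn (map size s2).
  by rewrite -szw -ssw E flatten_cat /= !size_cat !size_flatten /shape; lia.
(* The pair [u], [v] is the middle factor; the lengths of the other factors form the composition,
   cut after [s1]. *)
exists (size u + size v) => /=; first by lia.
exists (size u) => /=; first by lia.
exists (map size s1 ++ map size s2) => /=.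
  split; last by rewrite sumn_cat; lia.
  rewrite -map_cat all_map; have : all (factor k) (s1 ++ s2) by rewrite all_cat fs1.
  by apply: sub_all => y /factorP[_ /andP[]].
exists (size s1) => /=; first by rewrite size_cat !size_map; lia.
rewrite take_size_cat ?size_map // drop_size_cat ?size_map //.
exists (flatten s1); first exact: concs_flatten.
exists ((u ++ v) ++ flatten s2); last by rewrite -ssw E flatten_cat /= -!catA.
exists (u ++ v); last by exists (flatten s2) => //; apply: concs_flatten.
exists u; first by split => //; split => //; apply/asboolP.
exists v => //; rewrite addKn; split => //; split => //; exact/asboolPn.
Qed.

End SplitFamily.

(** Nonempty prefixes begin with [x], nonempty proper suffixes with [y]. This shows that the empty
    code is not maximal. *)
Lemma cons_nseq_overlap_free (T : Type) (x y : T) (n k : nat) :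
  x <> y -> k < n -> overlap_free k [set x :: nseq n.-1 y].
Proof.
move=> xy kn t u v t1k -> ->; case: t t1k => // t t1k.
rewrite /overlap /= size_nseq.
have -> : n.-1.+1 - t.+1 = (n.-2 - t).+1 by lia.
rewrite /= drop_nseq; have -> : n.-1 - (n.-2 - t) = t.+1 by lia.
by case=> - [].
Qed.

Theorem proposition6 (T : finType) (n k : nat) (C : set (seq T)) :
  2 <= #|T| -> 2 <= n -> 1 <= k <= n - 1 -> n <= 2 * k ->
  maximal_overlap_free n k C ->
  exists L R : nat -> set (seq T),
    admissible k L R /\ C = assoc_code n k L R.
Proof.
move=> T2 n2 k1n n2k [Cn Cfree Cmax].
have [c Cc] : C !=set0.
  apply/set0P/eqP => C0; have [x [y [_ _ /eqP xy]]] := card_gt1P T2.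
  apply: (Cmax (x :: nseq n.-1 y)).
    by rewrite C0 setD0 /words /= size_nseq; lia.
  by rewrite C0 set0U; apply: cons_nseq_overlap_free => //; lia.
(* The prefixes of codewords: a [p] longer than [u] is excluded, since [take] then returns [u]. *)
pose pre := [set p | exists2 u, C u & take (size p) u = p].
have npre p q : C (p ++ q) -> 0 < size q <= k -> ~ pre q.
  move=> Cpq qk [u Cu uq]; apply: (Cfree (size q) u (p ++ q)) => //; left.
  by rewrite uq size_cat addnK drop_size_cat.
have sub : C `<=` assoc_code n k (lpart pre) (rpart pre).
  move=> w Cw; apply: factorization_assoc_code; [lia | lia | exact: Cn | | ].
    by move=> p q E _; exists w => //; rewrite E take_size_cat.
  by move=> p q E; apply: (npre p); rewrite -E.
exists (lpart pre), (rpart pre); split.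
  (* The first letter of [c] lies in [L 1], its last letter in [R 1]. *)
  have := Cn _ Cc; rewrite /words /= => cn.
  apply: parts_admissible.
    case: c => [|x c] in Cc cn *; first by simpl in cn; lia.
    exists [:: x]; split => //; split; first exact: node_letter.
    by exists (x :: c); rewrite //= take0.
  case/lastP: c => [|c x] in Cc cn *; first by simpl in cn; lia.
  exists [:: x]; split => //; split; first exact: node_letter.
  by apply: (npre c); rewrite ?cats1 //=; lia.
(* Adding [w] to [C] stays inside the associated code, so it creates no overlap, against
   maximality. *)
apply/seteqP; split => // w aw; apply: contrapT => nCw.
apply: (Cmax w); first by split => //; have [] := assoc_codeP aw.
move=> t u v tk Cu Cv; apply: (assoc_code_overlap_free tk).
  by case: Cu => [/sub|->]; last exact: aw.
by case: Cv => [/sub|->]; last exact: aw.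
Qed.
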